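(* Let $r\ge 2$, $n\ge1$ and $0\le k\le n$ be integers. The set $\mathcal{ED}_{n,k}$ of extended $(n,k)$-descent monomials descends to a vector space basis of $R_{n,k}$.
   Context: Let $e_d(\mathbf{x}_n^r)=e_d(x_1^r,\dots,x_n^r)$ be the $d$-th elementary symmetric polynomial in $x_1^r,\dots,x_n^r$, let $$I_{n,k}=\langle x_1^{kr+1},\dots,x_n^{kr+1},e_n(\mathbf{x}_n^r),e_{n-1}(\mathbf{x}_n^r),\dots,e_{n-k+1}(\mathbf{x}_n^r)\rangle\subseteq\mathbb{C}[x_1,\dots,x_n]$$ and $R_{n,k}=\mathbb{C}[x_1,\dots,x_n]/I_{n,k}$. Let $G_n$ be the set of $r$-colored permutations $\pi_1^{c_1}\cdots\pi_n^{c_n}$, where $\pi_1\cdots\pi_n\in\mathfrak{S}_n$ and $c_i\in\{0,1,\dots,r-1\}$. Order colored letters by $$1^{r-1}<2^{r-1}<\cdots<1^{r-2}<2^{r-2}<\cdots<1^0<2^0<\cdots$$ (a higher color is smaller; within a color, order by letter value). For a word $w=w_1^{c_1}\cdots w_m^{c_m}$ of colored letters with distinct $w_1,\dots,w_m\in\{1,\dots,n\}$ (a partial colored permutation), let $\mathrm{Des}(w)=\{1\le i\le m-1:w_i^{c_i}>w_{i+1}^{c_{i+1}}\}$, $\mathrm{des}(w)=|\mathrm{Des}(w)|$, $d_i(w)=|\{j\in\mathrm{Des}(w):j\ge i\}|$ and $b_w=\prod_{i=1}^m x_{w_i}^{rd_i(w)+c_i}$. For $k\ge1$, $\mathcal{ED}_{n,k}$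 is the set of all monomials of the form $$\Bigl(\prod_{j=1}^z x_{\pi_j}^{kr}\Bigr)\cdot b_{\pi_{z+1}^{c_{z+1}}\cdots\pi_n^{c_n}}\cdot\bigl(x_{\pi_{z+1}}^{r i_{z+1}}x_{\pi_{z+2}}^{r i_{z+2}}\cdots x_{\pi_{n-k}}^{r i_{n-k}}\bigr),$$ where $0\le z\le n-k$, $\pi_1^{c_1}\cdots\pi_n^{c_n}\in G_n$ has $\mathrm{des}(\pi_{z+1}^{c_{z+1}}\cdots\pi_n^{c_n})<k$, and the integers $i_{z+1},\dots,i_{n-k}$ satisfy $$k-\mathrm{des}(\pi_{z+1}^{c_{z+1}}\cdots\pi_n^{c_n})>i_{z+1}\ge i_{z+2}\ge\cdots\ge i_{n-k}\ge0.$$ Also $\mathcal{ED}_{n,0}=\{1\}$. A set of monomials descends to a basis of a quotient if the cosets of its elements are pairwise distinct and form a basis. *)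

(* Defs.v *)
From HB Require Import structures.
From mathcomp Require Import all_boot all_order all_algebra perm.
From mathcomp Require Import boolp classical_sets reals complex mpoly.

Set Implicit Arguments.
Unset Strict Implicit.
Unset Printing Implicit Defensive.

Import GRing.Theory.

Local Open Scope ring_scope.
Local Open Scope quotient_scope.
Local Open Scope classical_set_scope.

Section LmodQuotient.
Variables (K : nzRingType) (V : lmodType K) (W : submodClosed V).

(* [submodClosed] does not inherit from [zmodClosed], on which the library
   quotients are built. *)
Definition zmod_of_submod : {pred V} := W.

HB.instance Definition _ := GRing.isZmodClosed.Build V zmod_of_submod
  (GRing.submod_closedB (submodClosedP W)).

Definition quot_mod : Type := {ideal_quot zmod_of_submod}.

HB.instance Definition _ := GRing.Zmodule.on quot_mod.

Definition quot_proj (v : V) : quot_mod := \pi_({ideal_quot zmod_of_submod}) v.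

Lemma quot_proj_eq (u v : V) : (quot_proj u == quot_proj v) = (u - v \in W).
Proof. by rewrite /quot_proj -Quotient.idealrBE. Qed.

Fact quot_proj_is_zmod_morphism : zmod_morphism quot_proj.
Proof. exact: raddfB. Qed.

HB.instance Definition _ := GRing.isZmodMorphism.Build V quot_mod quot_proj
  quot_proj_is_zmod_morphism.

Lemma quot_reprK : cancel (fun x : quot_mod => repr x) quot_proj.
Proof. exact: reprK. Qed.

Definition quot_scale (a : K) (x : quot_mod) : quot_mod :=
  quot_proj (a *: repr x).

Lemma quot_projZ (a : K) (v : V) :
  quot_proj (a *: v) = quot_scale a (quot_proj v).
Proof.
apply/eqP; rewrite quot_proj_eq -scalerBr.
by apply: rpredZ; rewrite -quot_proj_eq quot_reprK.
Qed.

Fact quot_scaleA a b x : quot_scale a (quot_scale b x) = quot_scale (a * b) x.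
Proof. by rewrite -[x]quot_reprK -!quot_projZ scalerA. Qed.

Fact quot_scale1 : left_id 1 quot_scale.
Proof. by move=> x; rewrite -[x]quot_reprK -!quot_projZ scale1r. Qed.

Fact quot_scaleDr : right_distributive quot_scale +%R.
Proof.
move=> a x y; rewrite -[x]quot_reprK -[y]quot_reprK.
by rewrite -raddfD -!quot_projZ scalerDr raddfD.
Qed.

Fact quot_scaleDl x : {morph quot_scale^~ x : a b / a + b}.
Proof.
by move=> a b; rewrite -[x]quot_reprK -!quot_projZ scalerDl raddfD.
Qed.

HB.instance Definition _ := GRing.Zmodule_isLmodule.Build K quot_mod
  quot_scaleA quot_scale1 quot_scaleDr quot_scaleDl.

Fact quot_proj_is_scalable : scalable quot_proj.
Proof. exact: quot_projZ. Qed.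

HB.instance Definition _ := GRing.isScalable.Build K V quot_mod *:%R quot_proj
  quot_proj_is_scalable.

End LmodQuotient.

Section Basis.
Variables (K : fieldType) (V : lmodType K).

Definition lin_indep (B : set V) : Prop :=
  forall (s : seq V) (a : V -> K), uniq s -> (forall v, v \in s -> B v) ->
    \sum_(v <- s) a v *: v = 0 -> forall v, v \in s -> a v = 0.

Definition spanning (B : set V) : Prop :=
  forall u : V, exists (s : seq V) (a : V -> K),
    (forall v, v \in s -> B v) /\ u = \sum_(v <- s) a v *: v.

Definition is_basis (B : set V) : Prop := lin_indep B /\ spanning B.

End Basis.

Definition descends_to_basis (K : fieldType) (V : lmodType K)
    (W : submodClosed V) (S : set V) : Prop :=
  {in S &, injective (quot_proj W)} /\ is_basis (quot_proj W @` S).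

Section GeneratedIdeal.
Variables (K : nzRingType) (A : lalgType K) (gens : seq A).

(* For commutative [A] this is the ideal generated by [gens]. *)
Definition ideal_gen : {pred A} := fun p =>
  `[< exists c : 'I_(size gens) -> A, p = \sum_i c i * gens`_i >].

Fact ideal_gen_submod_closed : submod_closed ideal_gen.
Proof.
split=> [|a p q /asboolP[c ->] /asboolP[d ->]]; apply/asboolP.
  by exists (fun=> 0); rewrite big1 // => i _; rewrite mul0r.
exists (fun i => a *: c i + d i); rewrite scaler_sumr -big_split /=.
by apply: eq_bigr => i _; rewrite mulrDl scalerAl.
Qed.

HB.instance Definition _ :=
  GRing.isSubmodClosed.Build K A ideal_gen ideal_gen_submod_closed.

End GeneratedIdeal.

Section ColoredWords.
Variables (n r : nat).

Definition colored_letter : Type := 'I_n * 'I_r.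

Definition colored_lt (a b : colored_letter) : bool :=
  (b.2 < a.2)%N || ((a.2 == b.2) && (a.1 < b.1)%N).

(* Positions in a word are numbered from 0, so that [i \in Des w] corresponds
   to a descent at position [i.+1] in the usual numbering. *)
Definition Des (m : nat) (w : m.-tuple colored_letter) : {set 'I_m} :=
  [set i : 'I_m | [exists j : 'I_m,
     (j == i.+1 :> nat) && colored_lt (tnth w j) (tnth w i)]].

Definition des (m : nat) (w : m.-tuple colored_letter) : nat := #|Des w|.

Definition d_from (m : nat) (w : m.-tuple colored_letter) (i : 'I_m) : nat :=
  #|[set j in Des w | (i <= j)%N]|.

Definition colored_perm : Type := 'S_n * {ffun 'I_n -> 'I_r}.

Definition word_of (g : colored_perm) : n.-tuple colored_letter :=
  [tuple (g.1 i, g.2 i) | i < n].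

Definition suffix_word (z : nat) (g : colored_perm) :
  (n - z).-tuple colored_letter := [tuple of drop z (word_of g)].

Variable K : fieldType.

Definition descent_mon (m : nat) (w : m.-tuple colored_letter) : {mpoly K[n]} :=
  \prod_(i < m) 'X_(tnth w i).1 ^+ (r * d_from w i + (tnth w i).2).

(* The exponents are given by [e : nat -> nat], where [e j] is i_(j+1); only the
   values at [z <= j < n - k] are used. *)
Definition ED (k : nat) : set {mpoly K[n]} :=
  if k == 0%N then [set 1] else
  [set p | exists (z : nat) (g : colored_perm) (e : nat -> nat),
    [/\ (z <= n - k)%N,
        (des (suffix_word z g) < k)%N,
        (z < n - k)%N -> (e z < k - des (suffix_word z g))%N,
        forall j, (z <= j)%N -> (j.+1 < n - k)%N -> (e j.+1 <= e j)%N
      & p = (\prod_(j < n | (j < z)%N) 'X_(g.1 j) ^+ (k * r))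
            * descent_mon (suffix_word z g)
            * \prod_(j < n | (z <= j < n - k)%N) 'X_(g.1 j) ^+ (r * e j)]].

Definition esym_pow (d : nat) : {mpoly K[n]} :=
  mesym n K d \mPo [tuple 'X_i ^+ r | i < n].

Definition I_gens (k : nat) : seq {mpoly K[n]} :=
  [seq 'X_i ^+ (k * r + 1) | i <- enum 'I_n] ++
  [seq esym_pow (n - j) | j <- iota 0 k].

Definition I_nk (k : nat) : submodClosed {mpoly K[n]} :=
  ideal_gen (I_gens k).

End ColoredWords.

(* Main.v *)
Require Import Defs.
From HB Require Import structures.
From mathcomp Require Import all_boot all_order all_algebra perm.
From mathcomp Require Import boolp classical_sets reals complex mpoly.
From mathcomp Require Import zify.

(** The proof is a triangularity argument on exponent vectors, valid over every
field.

Order the variables of a monomial x^a by decreasing exponent, ties by increasing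
index; this is the order of decreasing heights [a i * n + (n - i.+1)].  Call a
set T of variables a gap of a when x_T^r (the product of the x_t^r, t in T)
divides x^a and T still consists of the highest variables after the division,
say x^a = x^m x_T^r.  With d = |T|, the product x^m e_d(x^r) is the sum of the
x^m x_S^r over all S of size d, and x^a is the one of strictly greatest energy,
the energy being the sum of the squares of the heights ([energy_top]).  If
n < d + k then e_d(x^r) lies in the ideal, so that x^a can be rewritten into
monomials of smaller energy.  The standard monomials are those with no such gap
and all exponents at most kr; by induction on the energy they span the quotient
([standard_span]).

For independence, fix a standard a0 and let lam(a) be the coefficient of x^a0
in the result of rewriting x^a ([straightening_exists]).  Its linear extension
vanishes on the ideal, whence [standard_indep].  On x^m e_d(x^r) this is a
confluence statement ([layer_sum_eq0]): if the leading monomial is rewritten by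
means of another gap T', then T and T' are nested, and expanding
x^m0 e_d(x^r) e_d'(x^r) in two ways, with x^m0 the leading monomial divided by
x_T^r x_T'^r, reduces the claim to smaller energy.  On a monomial with a_j > kr
([big_exponent_eq0]) one uses that x_j^(kr) e_d(all x_i^r with i <> j) lies in
the ideal of the e_d(x^r) as soon as n <= d + k ([layer_sum_cofactor]): such a
monomial can be rewritten without touching the exponent of x_j, and so never
reaches a standard one.

Finally, the extended descent monomials are exactly the standard ones
([ED_standard]).  Read the variables by decreasing height and color each by its
exponent modulo r.  The exponents divided by r then decrease along the word, by
at least one at each descent, and there is a gap after a position exactly when
the drop there exceeds the minimum imposed by the descents
([height_descent]).  Having no gap among the last k positions says that the
last k quotients are the descent numbers, with nothing added to them. *)

Set Implicit Arguments.
Unset Strict Implicit.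
Unset Printing Implicit Defensive.

Import GRing.Theory.
Local Open Scope nat_scope.

Lemma addmAC n : right_commutative (@mnm_add n).
Proof. by move=> a b c; rewrite -!addmA [(b + c)%MM]addmC. Qed.

(** * Heights, energy and gaps of exponent vectors *)

Section Heights.
Variables (n r : nat).
Implicit Types (a m b : 'X_{1..n}) (S T V Q : {set 'I_n}).

(** A single number for the pair (exponent, index): the second summand is less than
    [n], so comparing heights compares exponents first and, in case of a tie,
    gives the smaller index the greater height. *)
Definition height a (i : 'I_n) : nat := a i * n + (n - i.+1).

Definition energy a : nat := \sum_i height a i ^ 2.

(** The exponent vector of the product of the x_i^r over [S]; multiplying by it
    raises the heights on [S] by [n * r]. *)
Definition boxes S : 'X_{1..n} := [multinom r * (i \in S) | i < n].

Definition is_top V m T := T \subset V /\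
  forall t u, t \in T -> u \in V -> u \notin T -> height m u < height m t.

Lemma height_boxes m S i :
  height (m + boxes S) i = height m i + (i \in S) * (n * r).
Proof. by rewrite /height mnmDE mnmE mulnDl addnAC [r * _]mulnC -mulnA [r * n]mulnC. Qed.

Lemma height_inj m : injective (height m).
Proof.
move=> i j /(congr1 (modn^~ n)); rewrite /height !modnMDl.
have := ltn_ord i; have := ltn_ord j => jn im.
by rewrite !modn_small; [move=> ?; apply: val_inj => /= |..]; lia.
Qed.

Lemma sum_indicator S (F : 'I_n -> nat) :
  \sum_i (i \in S) * F i = \sum_(i in S) F i.
Proof. by rewrite [RHS]big_mkcond; apply: eq_bigr => i _; case: (i \in S); lia. Qed.

(** The energy of x^m x_S^r depends on [S] only through its size and the sum of the
    heights of [m] on [S], so that at a given size the highest set wins. *)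
Lemma energy_boxes m S :
  energy (m + boxes S) =
  energy m + 2 * (n * r) * (\sum_(i in S) height m i) + (n * r) ^ 2 * #|S|.
Proof.
rewrite /energy -sum1_card -!sum_indicator !big_distrr -!big_split /=.
by apply: eq_bigr => i _; rewrite height_boxes; case: (i \in S); lia.
Qed.

Lemma top_exists V m D : D <= #|V| -> exists2 T, is_top V m T & #|T| = D.
Proof.
elim: D => [|D IH] ltD.
  by exists finset.set0; rewrite ?cards0 //; split=> [|t u]; rewrite ?finset.sub0set ?inE.
have [T [sTV topT] cT] := IH (ltnW ltD).
have [u0 u0P] : exists u, u \in V :\: T.
  by apply/card_gt0P; rewrite cardsD (finset.setIidPr sTV); lia.
case: (@arg_maxnP _ u0 (mem (V :\: T)) (height m) u0P) => u uP umax.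
have /setDP[uV uT] : u \in V :\: T by [].
exists (u |: T); last by rewrite cardsU1 uT cT.
split=> [|t v]; first by rewrite finset.subUset finset.sub1set uV.
rewrite !inE negb_or => /orP[/eqP->|tT] vV /andP[vu vT].
  rewrite ltn_neqAle andbC; apply/andP; split.
    by apply: umax; apply/setDP.
  by apply: contra vu => /eqP/height_inj->.
exact: topT.
Qed.

(** The sets [S] and [T] differ in equally many elements, and each of those of [T]
    is higher than the highest of those of [S]. *)
Lemma sum_top V m T S : is_top V m T -> S \subset V -> #|S| = #|T| -> S != T ->
  \sum_(i in S) height m i < \sum_(i in T) height m i.
Proof.
move=> [sTV topT] sSV cST neST.
rewrite (big_setID T) /= [ltnRHS](big_setID S) /= finset.setIC ltn_add2l.
have cD : #|S :\: T| = #|T :\: S|.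
  by rewrite !cardsD cST finset.setIC.
have [u0 u0P] : exists u, u \in S :\: T.
  apply/set0Pn; rewrite finset.setD_eq0; apply: contra neST => sST.
  by rewrite eqEcard sST cST /=.
case: (@arg_maxnP _ u0 (mem (S :\: T)) (height m) u0P) => u uP umax.
have c0 : 0 < #|S :\: T| by apply/card_gt0P; exists u0.
apply: (@leq_ltn_trans (#|S :\: T| * height m u)).
  by rewrite -sum_nat_const; apply: leq_sum => i /umax.
apply: (@leq_trans (#|T :\: S| * (height m u).+1)).
  by rewrite -cD ltn_pmul2l.
rewrite -sum_nat_const; apply: leq_sum => t; rewrite inE => /andP[_ tT].
have /setDP[uS uT] : u \in S :\: T by [].
by apply: topT => //; apply: (fintype.subsetP sSV).
Qed.

Lemma sum_top_le V m T S : is_top V m T -> S \subset V -> #|S| = #|T| ->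
  \sum_(i in S) height m i <= \sum_(i in T) height m i.
Proof.
move=> tT sSV cST; case: (eqVneq S T) => [->//|neST].
exact/ltnW/(sum_top tT).
Qed.

(** The leading term of x^m e_d(x_V^r), where d = |T|, is x^m x_T^r. *)
Lemma energy_top V m T S : 0 < r ->
  is_top V m T -> S \subset V -> #|S| = #|T| -> S != T ->
  energy (m + boxes S) < energy (m + boxes T).
Proof.
move=> r0 tT sSV cST neST.
have lt := sum_top tT sSV cST neST.
have n0 : 0 < n.
  case: (posnP n) => // n0; case/eqP: neST; apply/setP=> i.
  by have := ltn_ord i; rewrite {2}n0.
rewrite !energy_boxes cST ltn_add2r ltn_add2l ltn_pmul2l //; nia.
Qed.

(** The leading term of x^m e_d(x^r) e_d'(x^r).  Besides the two sums of heights,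
    the energy of x^m x_S'^r x_S^r counts the common elements of [S] and [S'];
    nestedness makes this number greatest at [T] and [T']. *)
Lemma energy_top2 m T T' S S' : 0 < r ->
  is_top finset.setT m T -> is_top finset.setT m T' ->
  (T \subset T') || (T' \subset T) ->
  #|S| = #|T| -> #|S'| = #|T'| -> S' != T' ->
  energy (m + boxes S' + boxes S) < energy (m + boxes T' + boxes T).
Proof.
move=> r0 tT tT' nest cS cS' neS'.
have lt := energy_top r0 tT' (finset.subsetT _) cS' neS'.
have le := sum_top_le tT (finset.subsetT _) cS.
rewrite [energy (_ + _ + boxes S)]energy_boxes.
rewrite [energy (_ + _ + boxes T)]energy_boxes cS ltn_add2r -addSn leq_add //.
have E (B A : {set 'I_n}) : \sum_(i in A) height (m + boxes B) i =
    \sum_(i in A) height m i + #|A :&: B| * (n * r).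
  rewrite (eq_bigr _ (fun i _ => height_boxes m B i)) big_split /=; congr (_ + _).
  rewrite -big_distrl /= -sum1_card; congr (_ * _).
  rewrite big_mkcond [RHS]big_mkcond; apply: eq_bigr => i _.
  by rewrite inE; case: (i \in A); case: (i \in B).
rewrite leq_pmul2l; last first.
  case: (posnP n) => // n0; last by nia.
  by case/eqP: neS'; apply/setP=> i; have := ltn_ord i; rewrite {2}n0.
rewrite !E leq_add // leq_mul2r; apply/orP; right.
have I1 : #|S :&: S'| <= #|T| by rewrite -cS subset_leq_card // subsetIl.
have I2 : #|S :&: S'| <= #|T'| by rewrite -cS' subset_leq_card // subsetIr.
by case/orP: nest => [/finset.setIidPl->|/finset.setIidPr->].
Qed.

(** The set [T] is a gap when [a] is [m + boxes T] for an [m] whose highest variables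
    are [T]: see [gap_boxes] and [gap_unbox]. *)
Definition gap V a T :=
  [&& T \subset V, [forall t in T, r <= a t] &
   [forall t in T, forall u in V :\: T, height a u + n * r < height a t]].

Lemma gapP V a T : reflect
  [/\ T \subset V, (forall t, t \in T -> r <= a t) &
   forall t u, t \in T -> u \in V -> u \notin T ->
     height a u + n * r < height a t] (gap V a T).
Proof.
apply: (iffP and3P) => [[sTV /forall_inP ge /forall_inP H]|[sTV ge H]].
  split=> // t u tT uV uT; have /forall_inP := H t tT.
  by apply; rewrite inE uT.
split=> //; apply/forall_inP => // t tT; apply/forall_inP => u.
by rewrite inE => /andP[uT uV]; apply: H.
Qed.

Lemma gap_boxes V m T : is_top V m T -> gap V (m + boxes T) T.
Proof.
move=> [sTV topT]; apply/gapP; split=> // [t tT|t u tT uV uT].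
  by rewrite mnmDE mnmE tT; lia.
by rewrite !height_boxes tT (negPf uT); have := topT t u tT uV uT; lia.
Qed.

Lemma gap_unbox V a T : gap V a T ->
  exists m, [/\ a = (m + boxes T)%MM & is_top V m T].
Proof.
move=> /gapP[sTV ge H]; exists (a - boxes T)%MM.
have E : a = (a - boxes T + boxes T)%MM.
  rewrite submK //; apply/mnm_lepP => i; rewrite mnmE.
  by case: (i \in T) (ge i) => [/(_ isT)|_]; lia.
split=> //; split=> // t u tT uV uT.
have := H t u tT uV uT; rewrite {1 2}E !height_boxes tT (negPf uT); lia.
Qed.

(** Heights differ by less than [n] within one exponent, so the height difference
    required of a gap forces the exponents themselves to differ by [r]. *)
Lemma gap_exponent V a T t u : gap V a T -> t \in T -> u \in V -> u \notin T ->
  a u + r <= a t.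
Proof.
move=> /gapP[_ _ H] tT uV uT; have := H t u tT uV uT.
rewrite /height; have := ltn_ord t; have := ltn_ord u; nia.
Qed.

Lemma gap_nested a T T' : gap finset.setT a T -> gap finset.setT a T' ->
  (T \subset T') || (T' \subset T).
Proof.
move=> gT gT'; apply/orP; case: (boolP (T \subset T')) => [|/subsetPn[t tT tT']].
  by left.
right; apply/fintype.subsetP => u uT'; case: (boolP (u \in T)) => // uT.
have [/gapP[_ _ H] /gapP[_ _ H']] := (gT, gT').
have := H t u tT (finset.in_setT _) uT.
by have := H' u t uT' (finset.in_setT _) tT'; lia.
Qed.

Lemma sym_diff_witness T T' : T != T' -> exists v, (v \in T) != (v \in T').
Proof.
move=> neT; apply/existsP; apply: contraR neT; rewrite negb_exists => /forallP H.
by apply/eqP/setP => v; move: (H v); rewrite negbK => /eqP.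
Qed.

(** The boxes of both gaps can be removed: a variable lying in both loses two boxes, but
    the variables lying in only one of them keep it high enough. *)
Lemma two_gaps_top a m T T' :
  gap finset.setT a T -> gap finset.setT a T' -> T != T' ->
  a = (m + boxes T + boxes T')%MM -> is_top finset.setT m T.
Proof.
move=> /gapP[_ _ H] /gapP[_ _ H'] /sym_diff_witness[v vP] E.
have hE i : height a i = height m i + (i \in T) * (n * r) + (i \in T') * (n * r).
  by rewrite {1}E !height_boxes.
split=> [|t u tT _ uT]; first exact: finset.subsetT.
have := H t u tT (finset.in_setT _) uT; rewrite !hE tT (negPf uT).
case: (boolP (t \in T')) => tT'; case: (boolP (u \in T')) => uT' /=; try lia.
(* Here t loses two boxes and u none, while T alone separates them by only one.
   The height of v lies between theirs, with a gap on either side. *)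
case: (boolP (v \in T)) vP => vT; case: (boolP (v \in T')) => vT' // _.
  have := H v u vT (finset.in_setT _) uT; have := H' t v tT' (finset.in_setT _) vT'.
  by rewrite !hE tT vT tT' (negPf uT) (negPf uT') (negPf vT'); lia.
have := H t v tT (finset.in_setT _) vT; have := H' v u vT' (finset.in_setT _) uT'.
by rewrite !hE tT vT' tT' (negPf uT) (negPf uT') (negPf vT); lia.
Qed.

Lemma gap_unbox2 a T T' : gap finset.setT a T -> gap finset.setT a T' -> T != T' ->
  exists m, [/\ a = (m + boxes T + boxes T')%MM,
    is_top finset.setT m T & is_top finset.setT m T'].
Proof.
move=> gT gT' neT; pose m := (a - (boxes T + boxes T'))%MM; exists m.
have [v vP] := sym_diff_witness neT.
have [/gapP[_ ge _] /gapP[_ ge' _]] := (gT, gT').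
have E : a = (m + boxes T + boxes T')%MM.
  rewrite -addmA submK //; apply/mnm_lepP => i; rewrite mnmDE !mnmE.
  have gi := ge i; have gi' := ge' i.
  case: (boolP (i \in T)) gi gi' => [iT|iT] gi; case: (boolP (i \in T')) => iT' gi'.
  - case: (boolP (v \in T)) vP => vT; case: (boolP (v \in T')) => vT' // _.
      by have := gap_exponent gT' iT' (finset.in_setT _) vT'; have := ge v vT; lia.
    by have := gap_exponent gT iT (finset.in_setT _) vT; have := ge' v vT'; lia.
  - by have := gi isT; lia.
  - by have := gi' isT; lia.
  - by lia.
split=> //; first exact: two_gaps_top gT gT' neT E.
by apply: two_gaps_top gT' gT _ _; rewrite 1?eq_sym // addmAC.
Qed.

End Heights.

(** * The coefficient of a standard monomial after rewriting *)

Section Functional.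
Variables (n r k : nat) (r_gt0 : 0 < r) (K : nzRingType).
Implicit Types (a m b : 'X_{1..n}) (S T V Q : {set 'I_n}).
Implicit Types (lam : 'X_{1..n} -> K).

(** The gaps along which x^a may be rewritten: e_d(x^r) with d = |T| is a generator
    of the ideal exactly for n - k < d <= n. *)
Definition reducing a T := gap r finset.setT a T && (n < #|T| + k).

(** The value on x^m e_D(x_V^r) of the linear functional whose value on x^a is
    [lam a]. *)
Definition layer_sum lam V m D : K :=
  (\sum_(S : {set 'I_n} | (S \subset V) && (#|S| == D)) lam (m + boxes r S)%MM)%R.

(** At each reducible exponent [lam] is compatible with one rewriting rule of its own
    choice; [layer_sum_eq0] shows that it is then compatible with all of them. *)
Definition straightens lam := forall a T0, reducing a T0 -> exists T m,
  [/\ reducing a T, a = (m + boxes r T)%MM & layer_sum lam finset.setT m #|T| = 0%R].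

Lemma layer_sumD1 lam V m T : T \subset V ->
  layer_sum lam V m #|T| = (lam (m + boxes r T)%MM +
  \sum_(S : {set 'I_n} | [&& S \subset V, #|S| == #|T| & S != T])
     lam (m + boxes r S)%MM)%R.
Proof.
move=> sTV; rewrite /layer_sum (bigD1 T) /= ?sTV ?eqxx //; congr (_ + _)%R.
by apply: eq_bigl => S; rewrite andbA.
Qed.

(** The rewriting terminates because the energy drops; here [N] bounds the number of
    steps, and [straighten_fuel] makes its value immaterial above the energy. *)
Fixpoint straighten (f : 'X_{1..n} -> K) (N : nat) a : K :=
  if [pick T | reducing a T] is Some T then
    if N is N'.+1 then
      (- \sum_(S : {set 'I_n} | [&& S \subset finset.setT, #|S| == #|T| & S != T])
           straighten f N' (a - boxes r T + boxes r S)%MM)%R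
    else 0%R
  else f a.

Lemma straighten_fuel f N N' a : energy a < N -> energy a < N' ->
  straighten f N a = straighten f N' a.
Proof.
elim: N N' a => [|N IH] [|N'] a //= leN leN'.
case: pickP => // T /andP[gT _].
have [m [Ea tT]] := gap_unbox gT.
congr (- _)%R; apply: eq_bigr => S /and3P[sS /eqP cS neS].
have lt := energy_top r_gt0 tT sS cS neS; rewrite -Ea in lt.
by apply: IH; rewrite Ea addmK; apply: leq_trans lt _; rewrite -ltnS.
Qed.

Lemma straightening_exists (f : 'X_{1..n} -> K) : exists lam,
  straightens lam /\ forall a, (forall T, ~~ reducing a T) -> lam a = f a.
Proof.
exists (fun a => straighten f (energy a).+1 a); split=> [a T0 rT0|a irr] /=; last first.
  by case: pickP => // T; rewrite (negPf (irr T)).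
have [T pT rT] : exists2 T, [pick T | reducing a T] = Some T & reducing a T.
  by case: pickP => [T rT|/(_ T0)]; [exists T | rewrite rT0].
have [m [Ea tT]] := gap_unbox (proj1 (andP rT)).
exists T, m; split=> //; rewrite layer_sumD1 ?finset.subsetT // -Ea /= pT.
apply/eqP; rewrite addrC subr_eq0; apply/eqP; apply: eq_bigr => S /and3P[sS /eqP cS neS].
have lt := energy_top r_gt0 tT sS cS neS; rewrite -Ea in lt.
by rewrite {2}Ea addmK; apply: (@straighten_fuel f (energy _).+1 (energy a)).
Qed.

(** The confluence of the rewriting.  The induction is on a bound for the energies of
    all terms of x^m e_D(x^r).  When the rule chosen at the leading exponent uses
    another gap [T'], the products x^m0 x_S^r e_d'(x^r) and x^m0 x_S'^r e_d(x^r) with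
    S <> T and S' <> T' have lower energy; summing the former over [S] and the
    latter over [S'] gives the same double sum. *)
Lemma layer_sum_eq0 lam m D : straightens lam -> n < D + k ->
  layer_sum lam finset.setT m D = 0%R.
Proof.
move=> slam.
suff H N : forall m D, n < D + k ->
    (forall Q, #|Q| = D -> energy (m + boxes r Q) < N) ->
    layer_sum lam finset.setT m D = 0%R.
  move=> ltn; apply: (H (\sum_(Q : {set 'I_n}) energy (m + boxes r Q)).+1) => // Q _.
  by rewrite ltnS (bigD1 Q) //= leq_addr.
elim: N => {m D} [|N IH] m D ltn ltN.
  by rewrite /layer_sum big1 // => S /andP[_ /eqP/ltN].
have [ltnD|leDn] := ltnP n D.
  rewrite /layer_sum big1 // => S /andP[_ /eqP cS].
  by have := max_card (mem S); rewrite card_ord cS leqNgt ltnD.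
(* x^m x_T^r is the leading term, and T' the gap that the chosen rule uses. *)
have [T tT cT] : exists2 T, is_top finset.setT m T & #|T| = D.
  by apply: top_exists; rewrite cardsT card_ord.
have rT : reducing (m + boxes r T) T by rewrite /reducing gap_boxes // cT.
have [T' [m' [rT' E' sum0]]] := slam _ _ rT.
have [ET|neT] := eqVneq T T'.
  move: E' sum0; rewrite -ET cT => /(congr1 (fun x => (x - boxes r T)%MM)).
  by rewrite !addmK => ->.
have [gT gT'] := (proj1 (andP rT), proj1 (andP rT')).
have [m0 [E0 top0 top0']] := gap_unbox2 gT gT' neT.
have Em : m = (m0 + boxes r T')%MM.
  by apply: (can_inj (addmK (boxes r T))); rewrite E0 addmAC.
have Em' : m' = (m0 + boxes r T)%MM.
  by apply: (can_inj (addmK (boxes r T'))); rewrite -E' E0.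
have nest := gap_nested gT gT'.
have leN : energy (m + boxes r T) <= N by rewrite -ltnS; apply: ltN.
(* the two expansions of the double sum over S and S' *)
have swap : (\sum_(S' : {set 'I_n} | (S' \subset finset.setT) && (#|S'| == #|T'|))
    layer_sum lam finset.setT (m0 + boxes r S') #|T|)%R = (
    \sum_(S : {set 'I_n} | (S \subset finset.setT) && (#|S| == #|T|))
    layer_sum lam finset.setT (m0 + boxes r S) #|T'|)%R.
  rewrite /layer_sum exchange_big /=; apply: eq_bigr => S _; apply: eq_bigr => S' _.
  by rewrite addmAC.
move: swap; rewrite (bigD1 T') ?finset.subsetT ?eqxx //= big1 => [|S']; last first.
  move=> /andP[/andP[_ /eqP cS'] neS']; apply: IH => [|Q cQ]; first by rewrite cT.
  apply: leq_trans leN; rewrite Em.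
  exact: energy_top2.
rewrite (bigD1 T) ?finset.subsetT ?eqxx //= big1 => [|S]; last first.
  move=> /andP[/andP[_ /eqP cS] neS]; apply: IH => [|Q cQ].
    by case/andP: rT'.
  apply: leq_trans leN; rewrite E0.
  by apply: energy_top2; rewrite // orbC.
by rewrite -Em -Em' sum0 !addr0 cT.
Qed.

(** With X = x_j^r and e'_D the elementary symmetric polynomial of the other x_i^r,
    e_(D+1) = e'_(D+1) + X e'_D.  Hence X^p e'_D is X^(p-1) e_(D+1), killed by
    [layer_sum_eq0], minus X^(p-1) e'_(D+1), killed by induction on [p]; for p = 0 there are too
    few variables left for e'_D. *)
Lemma layer_sum_cofactor lam j p m D : straightens lam ->
  p <= k -> p * r <= m j -> n <= D + p -> layer_sum lam (~: [set j]) m D = 0%R.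
Proof.
move=> slam; elim: p m D => [|p IH] m D lep lem len.
  rewrite /layer_sum big1 // => S /andP[/subset_leq_card leS /eqP cS].
  by move: leS len; rewrite cS cardsC1 card_ord; have := ltn_ord j; lia.
pose m1 := (m - boxes r [set j])%MM.
have Em : m = (m1 + boxes r [set j])%MM.
  rewrite submK //; apply/mnm_lepP => i; rewrite mnmE inE.
  by case: eqP => [->|_]; lia.
have m1j : p * r <= m1 j by rewrite mnmBE mnmE inE eqxx; lia.
have : layer_sum lam finset.setT m1 D.+1 = 0%R by apply: layer_sum_eq0 => //; lia.
rewrite /layer_sum (bigID (fun S : {set 'I_n} => j \in S)) /= addrC.
have -> : (\sum_(S : {set 'I_n} | (S \subset [set: 'I_n]) && (#|S| == D.+1) && (j \notin S))
   lam (m1 + boxes r S)%MM)%R = layer_sum lam (~: [set j]) m1 D.+1.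
  apply: eq_bigl => S; rewrite finset.subsetT /= andbC; congr (_ && _).
  by rewrite finset.subsetC finset.sub1set inE.
rewrite (IH m1 D.+1) //; [rewrite add0r|lia|lia] => sum0; apply: (etrans _ sum0).
(* the sets containing j correspond to their traces on the other variables *)
rewrite [RHS](reindex_onto (fun S => j |: S) (fun S => S :\ j)) /=; last first.
  by move=> S /andP[_ jS]; rewrite finset.setD1K.
apply: eq_big => [S|S /andP[sS _]].
  rewrite finset.subsetT setU11 andbT /= finset.subsetC finset.sub1set inE.
  case: (boolP (j \in S)) => jS /=.
    rewrite andbC; case: eqP => // E; move: jS; rewrite -E !inE eqxx; lia.
  by rewrite setU1K // eqxx andbT cardsU1 jS.
congr lam; rewrite Em -addmA; congr (_ + _)%MM; apply/mnmP => i; rewrite mnmDE !mnmE !inE.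
case: eqP => [->|_] /=; last by rewrite muln0.
have /negPf -> : j \notin S by move: sS; rewrite finset.subsetC finset.sub1set inE.
by rewrite muln0 addn0.
Qed.

(** A gap among all variables is, after removing [j], a gap among the other ones, and
    [layer_sum_cofactor] rewrites along it while the exponent of [j] stays the same.
    The irreducible monomials reached in this way have that large exponent. *)
Lemma big_exponent_eq0 lam a j : straightens lam ->
  (forall b, (forall T, ~~ reducing b T) -> k * r < b j -> lam b = 0%R) ->
  k * r < a j -> lam a = 0%R.
Proof.
move=> slam irr0; have [N] := ubnP (energy a); elim: N a => // N IH a leN bigj.
have [/existsP[T0 rT0]|] := boolP [exists T, reducing a T]; last first.
  by rewrite negb_exists => /forallP H; apply: irr0.
pose T := T0 :\ j.
have gT : gap r (~: [set j]) a T.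
  have /andP[/gapP[_ ge H] _] := rT0; apply/gapP; split=> [|t|t u].
  - by apply/fintype.subsetP => t; rewrite !inE => /andP[].
  - by rewrite inE => /andP[_ /ge].
  - rewrite !inE => /andP[_ tT] uj; rewrite uj /= => uT.
    exact: H (finset.in_setT _) uT.
have cT : n <= #|T| + k.
  case/andP: rT0 => _; rewrite (cardsD1 j T0) -/T => lt; rewrite -ltnS.
  by apply: leq_trans lt _; rewrite -addSn leq_add2r -add1n leq_add2r leq_b1.
have [m [Ea topT]] := gap_unbox gT.
have sT := proj1 topT.
have jS S : S \subset ~: [set j] -> j \notin S.
  by rewrite finset.subsetC finset.sub1set inE.
have aj S : S \subset ~: [set j] -> (m + boxes r S)%MM j = m j.
  by move=> /jS/negPf jNS; rewrite mnmDE mnmE jNS muln0 addn0.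
have mj : a j = m j by rewrite Ea aj.
have := @layer_sum_cofactor lam j k m #|T| slam (leqnn k).
rewrite -mj layer_sumD1 // -Ea => /(_ (ltnW bigj) cT).
rewrite big1 ?addr0 // => S /and3P[sS /eqP cS neS].
apply: IH; last by rewrite aj // -mj.
by rewrite -ltnS; apply: leq_trans leN; rewrite ltnS Ea; apply: energy_top topT _ _ _.
Qed.

End Functional.

Local Open Scope ring_scope.

(** * Linear functionals and monomial bases of quotients *)

Section LinearExtension.
Variables (n : nat) (K : nzRingType) (lam : 'X_{1..n} -> K).
Implicit Types p q : {mpoly K[n]}.

Definition mlift p : K := \sum_(m <- msupp p) p@_m * lam m.

Lemma mlift_seq p (s : seq 'X_{1..n}) : uniq s -> {subset msupp p <= s} ->
  mlift p = \sum_(m <- s) p@_m * lam m.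
Proof.
move=> us sps; rewrite (bigID (mem (msupp p))) /= [X in _ + X]big1 ?addr0.
  rewrite -big_filter; apply: perm_big; apply: uniq_perm => //.
  - exact: filter_uniq.
  - by move=> m; rewrite mem_filter andb_idr // => /sps.
by move=> m; rewrite -mcoeff_eq0 => /eqP->; rewrite mul0r.
Qed.

Fact mlift_is_linear : linear_for *%R mlift.
Proof.
move=> c p q; pose s := undup (msupp p ++ msupp q).
have us : uniq s := undup_uniq _.
rewrite !(@mlift_seq _ s) // => [|m|m|m].
- rewrite mulr_sumr -big_split /=; apply: eq_bigr => m _.
  by rewrite mcoeffD mcoeffZ mulrDl mulrA.
- by rewrite mem_undup mem_cat => ->; rewrite orbT.
- by rewrite mem_undup mem_cat => ->.
- by rewrite mem_undup => /msuppD_le; rewrite !mem_cat => /orP[/msuppZ_le->|->]; rewrite ?orbT.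
Qed.

HB.instance Definition _ := GRing.isLinear.Build K {mpoly K[n]} K *%R mlift
  mlift_is_linear.

Lemma mliftX m : mlift 'X_[m] = lam m.
Proof. by rewrite /mlift msuppX big_seq1 mcoeffX eqxx mul1r. Qed.

(** To vanish on the multiples of [g] it suffices to vanish on its monomial multiples. *)
Lemma mlift_mul_eq0 g : (forall m, mlift ('X_[m] * g) = 0) ->
  forall c, mlift (c * g) = 0.
Proof.
move=> H c; rewrite (mpolyE c) mulr_suml raddf_sum big1 //= => m _.
by rewrite -scalerAl linearZ /= H mulr0.
Qed.

End LinearExtension.

Section MonomialBasis.
Variables (n : nat) (K : fieldType).

(** The cosets of two monomials of [A] are distinct because their difference is one of
    the combinations that [W] contains only if they vanish. *)
Lemma monomial_basis (W : submodClosed {mpoly K[n]}) (A : {pred 'X_{1..n}})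
    (S : classical_sets.set {mpoly K[n]}) :
  (forall p, S p <-> exists2 a, a \in A & p = 'X_[a]) ->
  (forall p, p \in W -> {subset msupp p <= A} -> p = 0) ->
  (forall a, exists2 p, 'X_[a] - p \in W & {subset msupp p <= A}) ->
  descends_to_basis W S.
Proof.
move=> SA indep red.
have inS a : a \in A -> S 'X_[a] by move=> Aa; apply/SA; exists a.
have suppX a : a \in A -> {subset msupp ('X_[a] : {mpoly K[n]}) <= A}.
  by move=> Aa m; rewrite msuppX inE => /eqP->.
split; [|split].
- move=> p q /set_mem/SA[a Aa ->] /set_mem/SA[b Ab ->] /eqP.
  rewrite quot_proj_eq => /indep H; apply/subr0_eq/H => m /msuppB_le.
  by rewrite mem_cat => /orP[]; apply: suppX.
- move=> s c us sB sum0.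
  have [t tA st] : exists2 t : seq 'X_{1..n}, {subset t <= A} &
      s = [seq quot_proj W 'X_[m] | m <- t].
    elim: s sB {us sum0} => [|v s IH] sB; first by exists [::].
    have [|t tA ->] := IH; first by move=> w ws; apply: sB; rewrite inE ws orbT.
    have [p /SA[a Aa ->] <-] := sB v (mem_head _ _).
    by exists (a :: t) => // m; rewrite inE => /orP[/eqP->//|/tA].
  move: us sum0 {sB}; rewrite {}st => us; rewrite big_map => sum0 v /mapP[m mt ->].
  have ut := map_uniq us.
  pose p : {mpoly K[n]} := \sum_(m <- t) c (quot_proj W 'X_[m]) *: 'X_[m].
  have pE m' : m' \in t -> p@_m' = c (quot_proj W 'X_[m']).
    move=> mt'; rewrite raddf_sum (bigD1_seq m') //= big1 => [|m'' ne].
      by rewrite mcoeffZ mcoeffX eqxx mulr1 addr0.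
    by rewrite mcoeffZ mcoeffX (negPf ne) mulr0.
  rewrite -(pE m mt) (_ : p = 0) ?mcoeff0 //; apply: indep.
    have : quot_proj W p == quot_proj W 0.
      rewrite !raddf0 -sum0 raddf_sum; apply/eqP/eq_bigr => m' _ /=.
      by rewrite linearZ.
    by rewrite quot_proj_eq subr0.
  move=> m'; rewrite mcoeff_msupp; apply: contraR => /(contra (tA m')) m't.
  rewrite raddf_sum /= big_seq big1 // => m'' m''t; rewrite mcoeffZ mcoeffX.
  by case: eqP m't => [<-|]; rewrite ?m''t // mulr0.
- move=> u; pose Red p := exists2 q : {mpoly K[n]}, p - q \in W & {subset msupp q <= A}.
  have RedD p q c : Red p -> Red q -> Red (c *: p + q).
    move=> [p' Wp Ap] [q' Wq Aq]; exists (c *: p' + q').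
      by rewrite opprD addrACA -scalerBr rpredD // rpredZ.
    move=> m /msuppD_le; rewrite mem_cat => /orP[/msuppZ_le|]; [apply: Ap|apply: Aq].
  have RedE p : Red p.
    rewrite (mpolyE p); elim: (msupp p) => [|m s IH].
      by rewrite big_nil; exists 0; rewrite ?subr0 ?rpred0 // msupp0.
    by rewrite big_cons; apply: RedD.
  have [q Wq Aq] := RedE (repr u).
  pose pi m : quot_mod W := quot_proj W 'X_[m].
  exists (undup (map pi (msupp q))), (fun v => \sum_(m <- msupp q | pi m == v) q@_m).
  split=> [v|].
    by rewrite mem_undup => /mapP[m /Aq Am ->]; exists 'X_[m]; [apply: inS|].
  rewrite -[LHS](quot_reprK u) (eqP (_ : quot_proj W (repr u) == quot_proj W q)); last first.
    by rewrite quot_proj_eq.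
  rewrite {1}(mpolyE q) raddf_sum /=.
  under [RHS]eq_bigr do rewrite scaler_suml.
  rewrite (exchange_big_dep predT) //= [LHS]big_seq [RHS]big_seq.
  apply: eq_bigr => m mq; rewrite linearZ /= -/(pi m).
  have mem_m : pi m \in undup (map pi (msupp q)) by rewrite mem_undup map_f.
  rewrite big_mkcond (bigD1_seq (pi m)) ?undup_uniq //= eqxx big1 ?addr0 // => v.
  by rewrite eq_sym => /negPf->.
Qed.

End MonomialBasis.

(** * Standard monomials form a basis of the quotient *)

Section StandardBasis.
Variables (n r k : nat) (r_gt0 : (0 < r)%N) (K : fieldType).
Implicit Types (a m b : 'X_{1..n}) (T S : {set 'I_n}).
Local Notation I := (I_nk n r K k).

Definition standard : {pred 'X_{1..n}} := fun a =>
  [forall i, (a i <= k * r)%N] && [forall T, ~~ reducing r k a T].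

Lemma standardP a : reflect
  ((forall i, (a i <= k * r)%N) /\ forall T, ~~ reducing r k a T) (a \in standard).
Proof. by apply: (iffP andP) => -[/forallP ? /forallP ?]. Qed.

Lemma esym_pow_boxes d :
  esym_pow n r K d = \sum_(S : {set 'I_n} | #|S| == d) 'X_[boxes r S].
Proof.
rewrite /esym_pow /mesym raddf_sum /=; apply: eq_bigr => S _.
rewrite rmorph_prod mpolyXE_id /= big_mkcond /=; apply: eq_bigr => i _.
rewrite mnmE; case: (i \in S); last by rewrite muln0.
by rewrite muln1 comp_mpolyXU -tnth_nth tnth_mktuple.
Qed.

Lemma mul_esym_pow m d : 'X_[m] * esym_pow n r K d =
  \sum_(S : {set 'I_n} | (S \subset finset.setT) && (#|S| == d)) 'X_[m + boxes r S].
Proof.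
rewrite esym_pow_boxes mulr_sumr; apply: eq_big => S; first by rewrite finset.subsetT.
by rewrite mpolyXD.
Qed.

Lemma I_gens_mem g : g \in I_gens n r K k -> forall c, c * g \in I.
Proof.
move=> gI c; apply/asboolP.
have lt := gI; rewrite -index_mem in lt.
exists (fun i => if i == Ordinal lt then c else 0).
rewrite (bigD1 (Ordinal lt)) //= eqxx nth_index // big1 ?addr0 // => i /negPf->.
by rewrite mul0r.
Qed.

Lemma I_esym d m : (d <= n)%N -> (n < d + k)%N -> 'X_[m] * esym_pow n r K d \in I.
Proof.
move=> ledn ltn; apply: I_gens_mem; rewrite mem_cat; apply/orP; right.
by apply/mapP; exists (n - d)%N; rewrite ?mem_iota ?subKn //; lia.
Qed.

Lemma I_power (a : 'X_{1..n}) j : (k * r < a j)%N -> 'X_[a] \in I.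
Proof.
move=> ltj; pose b := (a - U_(j) *+ (k * r + 1))%MM.
have -> : a = (b + U_(j) *+ (k * r + 1))%MM.
  rewrite submK //; apply/mnm_lepP => i; rewrite mulmnE mnm1E.
  by case: eqP => [<-|_]; lia.
rewrite mpolyXD -mpolyXn; apply: I_gens_mem; rewrite mem_cat; apply/orP; left.
by apply/mapP; exists j; rewrite ?mem_enum.
Qed.

(** The functional attached to a standard [a0] returns the coefficient of x^a0 on a
    combination of standard monomials, and 0 on the ideal. *)
Lemma standard_indep p : p \in I -> {subset msupp p <= standard} -> p = 0.
Proof.
move=> /asboolP[c Ep] sp; apply/mpolyP => a0; rewrite mcoeff0.
have [Aa|] := boolP (a0 \in standard); last first.
  by move=> Na; apply/eqP; rewrite mcoeff_eq0; apply: contra Na => /sp.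
have [lam [slam irr]] := @straightening_exists n r k r_gt0 K (fun a => (a == a0)%:R).
have -> : p@_a0 = mlift lam p.
  have {1}-> : p = \sum_(m <- msupp p) p@_m *: 'X_[m] by apply: mpolyE.
  rewrite raddf_sum /mlift /= big_seq [RHS]big_seq.
  apply: eq_bigr => m /sp/standardP[_ mi].
  by rewrite mcoeffZ mcoeffX irr.
rewrite Ep raddf_sum big1 //= => i _; apply: mlift_mul_eq0 => m.
have : (I_gens n r K k)`_i \in I_gens n r K k by apply: mem_nth.
rewrite mem_cat => /orP[/mapP[j _ ->]|/mapP[d]].
  rewrite mpolyXn -mpolyXD mliftX; apply: (@big_exponent_eq0 n r k r_gt0 K lam _ j slam).
    move=> b bi; rewrite irr // => ltb; case: eqP => // E; move: ltb.
    by rewrite ltnNge E; case/standardP: Aa => ->.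
  by rewrite mnmDE mulmnE mnm1E eqxx; lia.
rewrite mem_iota add0n => /andP[_ ltd] ->; rewrite mul_esym_pow raddf_sum /=.
under eq_bigr do rewrite mliftX.
rewrite -[LHS]/(layer_sum r lam finset.setT m (n - d)%N).
by rewrite (layer_sum_eq0 r_gt0 _ slam) //; lia.
Qed.

(** The element x^m e_d(x^r) of the ideal, with x^m x_T^r = x^a for a gap [T], trades
    x^a for monomials of smaller energy. *)
Lemma standard_span a : exists2 p : {mpoly K[n]}, 'X_[a] - p \in I &
  {subset msupp p <= standard}.
Proof.
have [N] := ubnP (energy a); elim: N a => // N IH a leN.
have [Aa|] := boolP (a \in standard).
  exists 'X_[a]; first by rewrite subrr rpred0.
  by move=> m; rewrite msuppX inE => /eqP->.
rewrite negb_and => /orP[|]; rewrite negb_forall => /existsP.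
  move=> [j]; rewrite -ltnNge => ltj; exists 0; last by rewrite msupp0.
  by rewrite subr0 (I_power ltj).
move=> [T]; rewrite negbK => /andP[gT ltn].
have [m [Ea topT]] := gap_unbox gT.
pose Red p := exists2 q : {mpoly K[n]}, p - q \in I & {subset msupp q <= standard}.
suff [q Iq Aq] : Red (\sum_(S : {set 'I_n} |
    [&& S \subset finset.setT, #|S| == #|T| & S != T]) 'X_[m + boxes r S]).
  have := @I_esym #|T| m; rewrite mul_esym_pow (bigD1 T) ?finset.subsetT ?eqxx //=.
  rewrite -Ea; under eq_bigl do rewrite -andbA.
  have leT : (#|T| <= n)%N by rewrite -[n in (_ <= n)%N]card_ord max_card.
  move=> /(_ leT ltn) Isum; exists (- q).
    rewrite opprK; have := rpredB Isum Iq.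
    by rewrite opprB addrA -addrA [_ + q]addrC addrACA subrr addr0 addrC.
  move=> b; rewrite (perm_mem (msuppN _)); exact: Aq.
apply: (big_ind Red).
- by exists 0; rewrite ?subr0 ?rpred0 // msupp0.
- move=> p q [p' Ip Ap] [q' Iq Aq]; exists (p' + q').
    by rewrite opprD addrACA rpredD.
  by move=> b /msuppD_le; rewrite mem_cat => /orP[/Ap|/Aq].
- move=> S /and3P[sS /eqP cS neS]; apply: IH; rewrite -ltnS; apply: leq_trans leN.
  by rewrite ltnS Ea; apply: energy_top topT _ _ _.
Qed.

End StandardBasis.

(** * Descents of a colored word and of its suffixes *)

Section DescentCounts.
Variables (n r : nat).
Local Open Scope nat_scope.

Section Word.
Variables (m : nat) (w : m.-tuple (colored_letter n r)).
Implicit Types i j : 'I_m.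

Lemma mem_Des i j : j = i.+1 :> nat ->
  (i \in Des w) = colored_lt (tnth w j) (tnth w i).
Proof.
move=> ji; rewrite inE; apply/existsP/idP => [[j' /andP[/eqP j'i]]|lt].
  by have -> : j' = j by apply: val_inj; rewrite /= j'i ji.
by exists j; rewrite ji eqxx.
Qed.

(** With [d_from_last], this determines the descent numbers from right to left; the
    properties of suffixes follow from these two facts. *)
Lemma d_from_next i j : j = i.+1 :> nat ->
  d_from w i = colored_lt (tnth w j) (tnth w i) + d_from w j.
Proof.
move=> ji; rewrite /d_from (cardsD1 i) -(mem_Des ji) [i \in finset _]inE leqnn andbT.
congr (_ + _); apply: eq_card => t; rewrite !inE ji ltn_neqAle eq_sym.
by rewrite andbCA.
Qed.

Lemma d_from_last i : i.+1 = m -> d_from w i = 0.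
Proof.
move=> im; apply/eqP; rewrite cards_eq0; apply/eqP/setP => t; rewrite !inE.
apply/negP => /andP[/existsP[j /andP[/eqP jt _]] it].
by have := ltn_ord j; move: im it; rewrite jt; lia.
Qed.

Lemma d_from_lt i : d_from w i + i < m.
Proof.
have [N] := ubnP (m - i); elim: N i => // N IH i leN.
have [lt|] := ltnP i.+1 m; last first.
  by have lti := ltn_ord i; move=> le; rewrite d_from_last //; lia.
rewrite (@d_from_next i (Ordinal lt)) //; have := IH (Ordinal lt) _.
by case: colored_lt => /=; lia.
Qed.

Lemma d_from_mono i j : i <= j -> d_from w j <= d_from w i.
Proof.
move=> ij; apply: subset_leq_card; apply/fintype.subsetP => t.
by rewrite !inE => /andP[-> /(leq_trans ij)].
Qed.

Lemma des_d_from i : i = 0 :> nat -> des w = d_from w i.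
Proof. by move=> i0; apply: eq_card => t; rewrite !inE i0 andbT. Qed.

End Word.

Variable g : colored_perm n r.

Lemma tnth_word_of p : tnth (word_of g) p = (g.1 p, g.2 p).
Proof. by rewrite tnth_mktuple. Qed.

Lemma tnth_suffix_word z (i : 'I_(n - z)) (p : 'I_n) : p = z + i :> nat ->
  tnth (suffix_word z g) i = (g.1 p, g.2 p).
Proof.
move=> pi; rewrite -tnth_word_of (tnth_nth (g.1 p, g.2 p)) [RHS](tnth_nth (g.1 p, g.2 p)).
by rewrite /= nth_drop pi.
Qed.

Lemma d_from_suffix z (i : 'I_(n - z)) (p : 'I_n) : p = z + i :> nat ->
  d_from (suffix_word z g) i = d_from (word_of g) p.
Proof.
have [N] := ubnP (n - p); elim: N i p => // N IH i p leN pi.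
have ltp := ltn_ord p.
have [lt|le] := ltnP p.+1 n; last by rewrite !d_from_last //; lia.
have lti : i.+1 < n - z by lia.
rewrite (@d_from_next _ _ i (Ordinal lti)) // (@d_from_next _ _ p (Ordinal lt)) //.
rewrite (IH _ (Ordinal lt)) /=; [|lia..].
by rewrite !tnth_word_of (tnth_suffix_word pi) (@tnth_suffix_word _ _ (Ordinal lt)) //=; lia.
Qed.

Lemma des_suffix z (p : 'I_n) : p = z :> nat ->
  des (suffix_word z g) = d_from (word_of g) p.
Proof.
move=> pz; have lt : 0 < n - z by have := ltn_ord p; lia.
by rewrite (@des_d_from _ _ (Ordinal lt)) // (@d_from_suffix _ _ p) //= addn0.
Qed.

End DescentCounts.

Section DescentMonomials.
Variables (n r k : nat) (K : fieldType).
Implicit Types (a m b : 'X_{1..n}) (T S : {set 'I_n}).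

(** The exponent of the variable at position [p] of the word in the monomial built
    from [z], [g] and [e].  The descent number of the whole word may replace that of
    the suffix, as both count the descents from [p] on. *)
Definition ED_exponent (z : nat) (g : colored_perm n r) (e : nat -> nat) (p : 'I_n) : nat :=
  (if p < z then k * r else
   (d_from (word_of g) p + (if p < n - k then e p else 0)) * r + g.2 p)%N.

Lemma ED_monomial z (g : colored_perm n r) (e : nat -> nat) : (z <= n)%N ->
  (\prod_(j < n | (j < z)%N) 'X_(g.1 j) ^+ (k * r))
            * descent_mon K (suffix_word z g)
            * \prod_(j < n | (z <= j < n - k)%N) 'X_(g.1 j) ^+ (r * e j)
  = \prod_(p < n) 'X_(g.1 p) ^+ ED_exponent z g e p :> {mpoly K[n]}.
Proof.
move=> lezn.
have shiftP (i : 'I_(n - z)) : (z + i < n)%N by have := ltn_ord i; lia.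
pose h i := Ordinal (shiftP i).
have h_inj : injective h by move=> i j /(congr1 val) /= /addnI/val_inj.
have -> : descent_mon K (suffix_word z g) =
    \prod_(p < n | (z <= p)%N) 'X_(g.1 p) ^+ (r * d_from (word_of g) p + g.2 p).
  rewrite (eq_bigl (mem (h @: finset.setT))) => [|p]; last first.
    apply/idP/imsetP => [lezp|[i _ ->]]; last by rewrite leq_addr.
    have lt : (p - z < n - z)%N by have := ltn_ord p; lia.
    by exists (Ordinal lt) => //; apply: val_inj; rewrite /= subnKC.
  rewrite big_imset => [|i j _ _ /h_inj//]; apply: eq_big => [i|i _]; first by rewrite inE.
  by rewrite (@tnth_suffix_word _ _ g z i (h i)) //= (@d_from_suffix _ _ g z i (h i)).
rewrite big_mkcond [X in _ * X * _]big_mkcond [X in _ * X]big_mkcond -!big_split /=.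
apply: eq_bigr => p _; rewrite /ED_exponent; case: ltnP => zp /=.
  by rewrite !mulr1.
rewrite mul1r; case: ifP => _; rewrite ?mulr1 -?exprD; congr (_ ^+ _); lia.
Qed.

End DescentMonomials.

(** * Sorting the variables by height *)

Section Sorting.
Variables (n r : nat).
Local Open Scope nat_scope.
Implicit Types (a m b : 'X_{1..n}) (T S : {set 'I_n}).

Lemma ltn_digits d A B x y : x < d -> y < d ->
  (A * d + x < B * d + y) = (A < B) || (A == B) && (x < y).
Proof.
move=> xd yd; case: (ltngtP A B) => [lt|lt|->] /=; last by rewrite ltn_add2l.
  by apply: (@leq_trans (A.+1 * d)); rewrite ?mulSn; nia.
by apply/negbTE; rewrite -leqNgt; apply: (@leq_trans (B.+1 * d)); rewrite ?mulSn; nia.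
Qed.

Lemma eqn_digits d A B x y : x < d -> y < d ->
  (A * d + x == B * d + y) = (A == B) && (x == y).
Proof.
move=> xd yd; case: (ltngtP A B) => [lt|lt|->] /=; last by rewrite eqn_add2l.
  by apply/ltn_eqF; rewrite ltn_digits // lt.
by apply/gtn_eqF; rewrite ltn_digits // lt.
Qed.

(** The inequality of heights compares the quotients by [r] first, then the colors,
    then the indices, and the last two comparisons are those of colored letters,
    reversed.  For [x = 0] this says how the quotients of consecutive variables in
    the sorted order must drop, and for [x = 1] when there is a gap between them. *)
Lemma height_descent a (t u : 'I_n) (ct cu : 'I_r) x : t != u ->
  ct = a t %% r :> nat -> cu = a u %% r :> nat ->
  (height a u + x * (n * r) < height a t) =
  (a u %/ r + x + colored_lt (u, cu) (t, ct) <= a t %/ r).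
Proof.
move=> tu Et Eu; have [ltt ltu] := (ltn_ord t, ltn_ord u).
have ntu : (t : nat) != u by [].
have -> : height a u + x * (n * r) = (a u + x * r) * n + (n - u.+1).
  by rewrite /height mulnDl addnAC -mulnA [r * n]mulnC.
rewrite /height ltn_digits; [|lia..].
have -> : a u + x * r = (a u %/ r + x) * r + cu.
  by rewrite mulnDl addnAC Eu -divn_eq.
have Ea : a t = a t %/ r * r + ct by rewrite Et -divn_eq.
move: (a t %/ r) Ea => qt ->.
rewrite ltn_digits ?eqn_digits ?ltn_ord // /colored_lt /= [cu == ct]eq_sym.
have -> : (ct == cu) = (ct == cu :> nat) by [].
have -> : (n - u.+1 < n - t.+1) = (t < u) by lia.
case: (ltngtP (a u %/ r + x) qt) => [lt|lt|->] /=.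
- by case: (_ || _) => /=; lia.
- by case: (_ || _) => /=; lia.
- case: (ltngtP cu ct) => /= _; rewrite ?addn0 ?leqnn ?addn1 ?ltnn //.
  by move: ntu; case: ltngtP => //= _ _; rewrite ?addn0 ?leqnn ?addn1 ?ltnn.
Qed.

(** The number of higher variables is the position of a variable in the sorted order;
    the permutation is the inverse of this bijection. *)
Lemma sorting_perm a : exists g : 'S_n,
  forall p q : 'I_n, p < q -> height a (g q) < height a (g p).
Proof.
have rank_lt i : #|[set j | height a i < height a j]| < n.
  rewrite -[ltnRHS]card_ord; apply: proper_card; apply/properP; split.
    by apply/fintype.subsetP.
  by exists i; rewrite ?inE ?ltnn.
pose rank i := Ordinal (rank_lt i).
have rank_anti i j : height a j < height a i -> rank i < rank j.
  move=> lt; apply: proper_card; apply/properP; split.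
    by apply/fintype.subsetP => l; rewrite !inE; apply: ltn_trans.
  by exists i; rewrite inE ?ltnn.
have rank_inj : injective rank.
  move=> i j E; apply: (@height_inj _ a).
  by case: (ltngtP (height a i) (height a j)) => // /rank_anti; rewrite E ltnn.
exists (perm rank_inj)^-1%g => p q; set g := (_^-1)%g => pq.
have rg x : rank (g x) = x by rewrite -[RHS](permKV (perm rank_inj) x) permE.
case: (ltngtP (height a (g q)) (height a (g p))) => //.
  by move=> /rank_anti; rewrite !rg ltnNge (ltnW pq).
by move=> /height_inj E; move: pq; rewrite -(rg p) -(rg q) E ltnn.
Qed.

Lemma card_initial z : z <= n -> #|[set p : 'I_n | p < z]| = z.
Proof.
move=> lez; rewrite -sum1_card (eq_bigl (fun p : 'I_n => p < z)) => [|p]; last by rewrite inE.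
by rewrite -(big_ord_widen n (fun=> 1) lez) sum1_card card_ord.
Qed.

Lemma initial_segment (P : pred 'I_n) :
  (forall p q : 'I_n, p < q -> P q -> P p) ->
  exists2 z, z <= n & forall p : 'I_n, P p = (p < z).
Proof.
move=> down; have exz : exists z, [forall p : 'I_n, P p ==> (p < z)].
  by exists n; apply/forall_inP => p _.
case: (ex_minnP exz) => z /forall_inP zP zmin; exists z.
  by apply: zmin; apply/forall_inP => p _.
move=> p; apply/idP/idP => [/zP//|pz]; apply: contraLR pz => NPp; rewrite -leqNgt.
apply: zmin; apply/forall_inP => q Pq; rewrite ltnNge; apply: contra NPp.
by rewrite leq_eqVlt => /orP[/eqP/val_inj->//|/down]; apply.
Qed.

End Sorting.

(** * Extended descent monomials are the standard monomials *)

Section Identification.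
Variables (n r k : nat) (r_gt0 : (0 < r)%N) (k_gt0 : (0 < k)%N) (le_kn : (k <= n)%N).
Local Open Scope nat_scope.
Implicit Types (a m b : 'X_{1..n}) (T S : {set 'I_n}) (g : colored_perm n r).

Lemma ED_exponent_divn z g e (p : 'I_n) : z <= p ->
  ED_exponent k z g e p %/ r =
  d_from (word_of g) p + (if p < n - k then e p else 0).
Proof.
by move=> zp; rewrite /ED_exponent ltnNge zp /= divnMDl // divn_small ?addn0.
Qed.

Lemma ED_exponent_modn z g e (p : 'I_n) : z <= p -> ED_exponent k z g e p %% r = g.2 p.
Proof. by move=> zp; rewrite /ED_exponent ltnNge zp /= modnMDl modn_small. Qed.

(** A gap with more than n - k elements contains a letter at one of the last [k]
    positions.  At the rightmost such letter the quotient would have to drop by more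
    than the descent there accounts for, but the quotients at those positions are
    the descent numbers. *)
Lemma ED_exponent_standard z g (e : nat -> nat) a :
  z <= n - k ->
  (z < n - k -> e z < k - des (suffix_word z g)) ->
  (forall j, z <= j -> j.+1 < n - k -> e j.+1 <= e j) ->
  (forall p, a (g.1 p) = ED_exponent k z g e p) -> a \in standard r k.
Proof.
move=> lez ez emono aE.
have surj i : exists p, i = g.1 p by exists (g.1^-1%g i); rewrite permKV.
have e_le j : z <= j -> j < n - k -> e j <= e z.
  elim: j => [|j IH]; first by rewrite leqn0 => /eqP->.
  rewrite leq_eqVlt => /orP[/eqP->//|zj] lt.
  by apply: leq_trans (emono j zj lt) (IH zj (ltnW lt)).
apply/standardP; split=> [i|T].
  have [p ->] := surj i; rewrite aE; have [pz|zp] := ltnP p z.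
    by rewrite /ED_exponent pz.
  suff : ED_exponent k z g e p %/ r < k by rewrite ltn_divLR // => /ltnW.
  rewrite ED_exponent_divn //; have := d_from_lt (word_of g) p.
  case: (ltnP p (n - k)) => pk; last by lia.
  have zn : z < n by lia.
  have := d_from_mono (word_of g) (zp : Ordinal zn <= p).
  rewrite -(@des_suffix _ _ g z (Ordinal zn)) //.
  by have := e_le p zp pk; have := ez (leq_ltn_trans zp pk); lia.
apply/negP => /andP[/gapP[_ ge H] ltT].
have [p0 pT0 lep0] : exists2 p : 'I_n, g.1 p \in T & n - k <= p.
  apply/exists_inP; apply: contraLR ltT; rewrite negb_exists => /forallP lt.
  suff : #|T| <= n - k by lia.
  rewrite -[leqRHS](card_initial (leq_subr k n)) -[leqRHS](card_imset _ (@perm_inj _ g.1)).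
  apply: subset_leq_card; apply/fintype.subsetP => i iT; have [p Ep] := surj i.
  have := lt p; rewrite Ep negb_and -Ep iT /= -ltnNge => ltp.
  by rewrite Ep imset_f // inE.
(* the rightmost letter of the gap *)
case: (@arg_maxnP _ p0 (fun p : 'I_n => g.1 p \in T) val pT0) => p pT pmax.
have lep : n - k <= p by apply: leq_trans lep0 (pmax _ pT0).
have zp : z <= p by apply: leq_trans lez lep.
have q_p : a (g.1 p) %/ r = d_from (word_of g) p.
  by rewrite aE ED_exponent_divn // ltnNge lep addn0.
have [lt|le] := ltnP p.+1 n; last first.
  have := ge _ pT; rewrite -divn_gt0 // q_p d_from_last //.
  by apply/eqP; rewrite eqn_leq le ltn_ord.
pose p' := Ordinal lt.
have p'T : g.1 p' \notin T by apply/negP => /pmax; rewrite /= ltnn.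
have q_p' : a (g.1 p') %/ r = d_from (word_of g) p'.
  by rewrite aE ED_exponent_divn /= ?(leqW zp) // ltnNge (leqW lep) addn0.
have ne : g.1 p != g.1 p' by apply: contra p'T => /eqP<-.
have := H _ _ pT (finset.in_setT _) p'T.
rewrite -[n * r]mul1n (@height_descent _ _ a _ _ (g.2 p) (g.2 p')) //.
- rewrite q_p q_p' (@d_from_next _ _ _ _ p p') // !tnth_word_of.
  by case: colored_lt => /=; lia.
- by rewrite aE ED_exponent_modn.
- by rewrite aE ED_exponent_modn //= leqW.
Qed.

(** The word is the list of variables in sorted order, colored by the exponents modulo
    [r]; the [e j] are the excesses of the quotients over the descent numbers, and
    [z] counts the exponents equal to [k * r], which come first. *)
Lemma standard_ED_exponent a : a \in standard r k ->
  exists z g (e : nat -> nat),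
    [/\ z <= n - k, des (suffix_word z g) < k,
        z < n - k -> e z < k - des (suffix_word z g),
        forall j, z <= j -> j.+1 < n - k -> e j.+1 <= e j
      & forall p, a (g.1 p) = ED_exponent k z g e p].
Proof.
move=> /standardP[ale airr].
have [s sorted] := sorting_perm a.
have height_le (p q : 'I_n) : p <= q -> height a (s q) <= height a (s p).
  by rewrite leq_eqVlt => /orP[/eqP/val_inj->//|/sorted/ltnW].
have exponent_le i j : height a i <= height a j -> a i <= a j.
  have [lti ltj] := (ltn_ord i, ltn_ord j).
  apply: contraLR; rewrite -!ltnNge => lt.
  by rewrite /height ltn_digits ?lt //; lia.
have [z lez zP] : exists2 z, z <= n & forall p, (a (s p) == k * r) = (p < z).
  apply: initial_segment => p q pq /eqP E; rewrite eqn_leq ale -E.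
  exact/exponent_le/ltnW/sorted.
have colP (i : 'I_n) : a i %% r < r by rewrite ltn_mod.
pose g : colored_perm n r := (s, [ffun p => Ordinal (colP (s p))]).
have colE p : g.2 p = a (s p) %% r :> nat by rewrite ffunE.
pose d p := d_from (word_of g) p.
pose q p := a (s p) %/ r.
have step (p p' : 'I_n) x : p' = p.+1 :> nat ->
    (height a (s p') + x * (n * r) < height a (s p)) = (q p' + x + (d p - d p') <= q p).
  move=> pp'; have ne : s p != s p'.
    by rewrite (inj_eq perm_inj) -val_eqE /= pp'; lia.
  rewrite (height_descent _ ne (colE p) (colE p')).
  by rewrite /d (@d_from_next _ _ _ _ p p') // !tnth_word_of addnK.
have d_le (p p' : 'I_n) : p' = p.+1 :> nat -> d p' <= d p.
  by move=> pp'; apply: d_from_mono; rewrite pp'.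
have step0 (p p' : 'I_n) : p' = p.+1 :> nat -> q p' + (d p - d p') <= q p.
  by move=> pp'; have := step p p' 0 pp'; rewrite addn0 mul0n addn0 sorted ?pp'.
(* Otherwise the variables up to p would be a gap, of size p + 1 > n - k.  The
   induction runs from the last position to the left. *)
have tight (p : 'I_n) : n - k <= p -> q p = d p.
  have [N] := ubnP (n - p); elim: N p => // N IH p leN lep.
  pose T := [set s i | i in [set i : 'I_n | i < p.+1]].
  have memT i : (s i \in T) = (i <= p).
    by rewrite mem_imset ?inE //; exact: perm_inj.
  have cT : #|T| = p.+1.
    by rewrite card_imset; [exact: card_initial|exact: perm_inj].
  have := airr T; rewrite /reducing cT (_ : n < p.+1 + k) ?andbT; last by lia.
  have gapT : (forall u : 'I_n, u \notin T -> height a u + n * r < height a (s p)) ->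
      r <= a (s p) ->
      gap r finset.setT a T.
    move=> H1 H2; apply/gapP; split=> [|t|t u].
    - exact: finset.subsetT.
    - rewrite -[t](permKV s) memT => tp; apply: leq_trans H2 _.
      exact/exponent_le/height_le.
    - rewrite -[t](permKV s) memT => tp _ /H1 /leq_trans; apply; exact: height_le.
  have [lt|le] := ltnP p.+1 n; last first.
    have pn : p.+1 = n by apply/eqP; rewrite eqn_leq le ltn_ord.
    rewrite /d d_from_last // => Ngap; apply/eqP; rewrite /q -leqn0 leqNgt divn_gt0 //.
    apply: contra Ngap => /gapT; apply=> u; rewrite -[u](permKV s) memT.
    have := ltn_ord (s^-1%g u); lia.
  pose p' := Ordinal lt; have Ep' : p' = p.+1 :> nat by [].
  have qp' : q p' = d p' by apply: IH => /=; lia.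
  have ge := step0 p p' Ep'; have dle := d_le p p' Ep'.
  move=> Ngap; apply/eqP; rewrite eqn_leq; apply/andP; split; last by lia.
  rewrite leqNgt; apply: contra Ngap => ltq.
  have lt1 : height a (s p') + 1 * (n * r) < height a (s p) by rewrite (step _ _ _ Ep'); lia.
  apply: gapT => [u|]; last by rewrite -divn_gt0 //; apply: leq_trans ltq.
  rewrite -[u](permKV s) memT -ltnNge => ltu.
  apply: leq_ltn_trans lt1; rewrite mul1n leq_add2r; exact: height_le.
(* At position n - k the quotient is a descent number, hence at most k - 1, whereas
   the first z quotients are k. *)
have zk : z <= n - k.
  rewrite leqNgt; apply/negP => ltz.
  have ltn : n - k < n by lia.
  have := tight (Ordinal ltn) (leqnn _); have := zP (Ordinal ltn); rewrite /= ltz.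
  move=> /eqP E; rewrite /q E mulnK //; have := d_from_lt (word_of g) (Ordinal ltn).
  by rewrite /d /=; lia.
have d_le_q (p : 'I_n) : d p <= q p.
  have [N] := ubnP (n - p); elim: N p => // N IH p leN.
  have [lt|le] := ltnP p.+1 n; last first.
    by rewrite /d d_from_last //; apply/eqP; rewrite eqn_leq le ltn_ord.
  have := IH (Ordinal lt) _; have := @step0 p (Ordinal lt) erefl.
  have := @d_le p (Ordinal lt) erefl; rewrite /=; lia.
have zn : z < n by lia.
pose oz := Ordinal zn.
have qlt : q oz < k.
  have : a (s oz) != k * r by rewrite zP /= ltnn.
  by rewrite /q ltn_divLR // ltn_neqAle ale andbT.
have des_z : des (suffix_word z g) = d oz by rewrite (@des_suffix _ _ g z oz).
pose e j := if insub j is Some p then q p - d p else 0.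
have eE (p : 'I_n) : e p = q p - d p by rewrite /e valK.
exists z, g, e; split=> //.
- by rewrite des_z; apply: leq_ltn_trans qlt.
- by move=> _; rewrite des_z (eE oz); have := d_le_q oz; lia.
- move=> j zj ltj; have lt1 : j.+1 < n by lia.
  have := eE (Ordinal lt1); have := eE (Ordinal (ltnW lt1)); rewrite /= => -> ->.
  have := @step0 (Ordinal (ltnW lt1)) (Ordinal lt1) erefl.
  have := @d_le (Ordinal (ltnW lt1)) (Ordinal lt1) erefl; lia.
- move=> p; rewrite /ED_exponent; case: ltnP => [pz|zp].
    by apply/eqP; rewrite zP.
  rewrite {1}(divn_eq (a (s p)) r) colE; congr (_ * _ + _).
  case: ltnP => [ltp|lep]; first by rewrite eE subnKC.
  by rewrite addn0; apply: tight.
Qed.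

End Identification.

Lemma ED_standard (n r k : nat) (K : fieldType) (p : {mpoly K[n]}) :
  (0 < r)%N -> (k <= n)%N ->
  ED r k p <-> exists2 a, a \in @standard n r k & p = 'X_[a].
Proof.
move=> r_gt0 le_kn; rewrite /ED; have [k0|k_gt0] := posnP k.
  rewrite k0; split=> [->|[a /standardP[a0 _] ->]].
    exists 0%MM; last by rewrite mpolyX0.
    apply/standardP; split=> [i|T]; first by rewrite mnm0E.
    by rewrite negb_and -leqNgt addn0 -[n in (_ <= n)%N]card_ord max_card orbT.
  rewrite /= (_ : a = 0%MM) ?mpolyX0 //; apply/mnmP => i.
  by rewrite mnm0E; apply/eqP; rewrite -leqn0.
split=> [[z [g [e [lez desk ez emono ->]]]]|[a /(standard_ED_exponent r_gt0 k_gt0 le_kn)]].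
  rewrite ED_monomial; last by lia.
  pose a : 'X_{1..n} := [multinom ED_exponent k z g e ((g.1)^-1%g i) | i < n].
  have aE q : a (g.1 q) = ED_exponent k z g e q by rewrite mnmE permK.
  exists a; first exact: ED_exponent_standard lez ez emono aE.
  by rewrite (mpolyXE _ g.1); apply: eq_bigr => q _; rewrite aE.
move=> [z [g [e [lez desk ez emono aE]]]] ->; exists z, g, e; split=> //.
rewrite ED_monomial; last by lia.
by rewrite (mpolyXE _ g.1); apply: eq_bigr => q _; rewrite aE.
Qed.

Theorem theorem5p10 (R : realType) (r n k : nat) :
  (2 <= r)%N -> (1 <= n)%N -> (k <= n)%N ->
  descends_to_basis (I_nk n r R[i] k) (@ED n r R[i] k).
Proof.
move=> r2 _ le_kn; have r_gt0 : (0 < r)%N by apply: ltnW.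
apply: (@monomial_basis _ _ _ (@standard n r k)).
- by move=> p; apply: ED_standard.
- exact: standard_indep.
- exact: standard_span.
Qed.
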